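(* Let $A\in\mathbb{R}^{m\times n}$ and let $V\in\mathbb{R}^{n\times r}$ have orthonormal columns. Let $I$ and $J$ be the random index sets of cardinality $r$ returned by Adaptive Randomized Pivoting for cross approximation (ARPcross) applied to $A$ and $V$, and assume that $A(I,J)$ is invertible with probability one (so that the cross approximation below exists). Then $$\mathbb{E}\left[\|A-A(:,J)A(I,J)^{-1}A(I,:)\|_F^2\right]\le (r+1)^2\,\|A-AVV^T\|_F^2 .$$
   Context: $\|\cdot\|_F$ is the Frobenius norm. For index tuples $I,J$, $A(:,J)$, $A(I,:)$, $A(I,J)$ denote the submatrices of $A$ with columns $J$, with rows $I$, and with rows $I$ and columns $J$, respectively. Adaptive Randomized Pivoting (ARP). Input: $V\in\mathbb{R}^{n\times r}$ with orthonormal columns. Set $W_0=V$. For $k=1,\ldots,r$: set $p_j=\|W_{k-1}(j,k:r)\|_2^2/(r-k+1)$ for $j=1,\ldots,n$ (a probability distribution on $\{1,\dots,n\}$), where $W_{k-1}(j,k:r)$ is row $j$ restricted to columns $k,\ldots,r$; sample $j_k$ according to the probabilities $p_j$; set $W_k=W_{k-1}Q_k$, where $Q_k=\mathrm{diag}(\mathrm{Id}_{k-1},H_k)\in\mathbb{R}^{r\times r}$ and $H_k\in\mathbb{R}^{(r-k+1)\times(r-k+1)}$ is a Householder reflector $\mathrm{Id}-2u_ku_k^T$ with a unit vector $u_k$ (or the identity, if there is nothing to annihilate), chosen such that $W_{k-1}(j_k,k:r)H_k$ is a multiple of the first unit row vector, i.e. $W_k(j_k,k+1:r)=0$. Output: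 $J=(j_1,\ldots,j_r)$. With probability one, the indices are distinct and $V(J,:)$ is invertible. ARPcross. Input: $A\in\mathbb{R}^{m\times n}$ and $V\in\mathbb{R}^{n\times r}$ with orthonormal columns. (1) Obtain $J$ by applying ARP to $V$. (2) Compute, by a QR decomposition, a matrix $Q_J\in\mathbb{R}^{m\times r}$ whose columns form an orthonormal basis of the column space of $A(:,J)$. (3) Obtain $I$ by applying ARP to $Q_J$ (with fresh randomness, conditionally on $J$). Output: $I,J$. *)

(* Defs.v *)
From mathcomp Require Import all_boot all_order all_algebra.

Set Implicit Arguments.
Unset Strict Implicit.
Unset Printing Implicit Defensive.

Import Order.TTheory GRing.Theory Num.Theory.
Local Open Scope ring_scope.

(* The Frobenius norm; on a row vector it is the Euclidean norm. *)
Definition normF (R : rcfType) (m n : nat) (A : 'M[R]_(m, n)) : R :=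
  Num.sqrt (\sum_(i < m) \sum_(j < n) A i j ^+ 2).

Definition orthonormal_cols (R : rcfType) (m n : nat) (Q : 'M[R]_(m, n)) : Prop :=
  Q^T *m Q = 1%:M.

Definition orthonormal_colbasis (R : rcfType) (m r s : nat)
    (Q : 'M[R]_(m, r)) (B : 'M[R]_(m, s)) : Prop :=
  orthonormal_cols Q /\ (Q^T == B^T)%MS.

(* [H] is the identity or a Householder reflector, and [x *m H] is a multiple
   of the first unit row vector.  The identity satisfies the last condition
   only if there is nothing to annihilate in [x]. *)
Definition householder_for (R : rcfType) (d : nat)
    (x : 'rV[R]_d.+1) (H : 'M[R]_d.+1) : Prop :=
  (H = 1%:M \/
   exists2 u : 'cV[R]_d.+1, normF u = 1 & H = 1%:M - 2 *: (u *m u^T)) /\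
  exists c : R, x *m H = c *: delta_mx 0 0.

(* A reflector is not determined by the vector it acts on.  The one used in a
   step may depend on all indices drawn so far (first argument, in the order
   in which they were drawn, including the current one). *)
Definition reflector_rule (R : rcfType) (n : nat) : Type :=
  seq 'I_n -> forall d : nat, 'rV[R]_d.+1 -> 'M[R]_d.+1.

Definition valid_rule (R : rcfType) (n : nat) (H : reflector_rule R n) : Prop :=
  forall (h : seq 'I_n) (d : nat) (x : 'rV[R]_d.+1), householder_for x (H h d x).

(* The probability that ARP, after k steps which drew the indices [h] and led
   to the matrix [W], draws the d indices [s] in its d remaining steps.  The
   columns of [W] are split as k + d, so that [rsubmx (row j W)] is the part
   of row j on which the sampling probabilities of the next step depend. *)
Fixpoint arp_prob_from (R : rcfType) (n : nat) (H : reflector_rule R n)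
    (h : seq 'I_n) (k d : nat) : 'M[R]_(n, k + d) -> seq 'I_n -> R :=
  match d with
  | 0 => fun _ s => (s == [::])%:R
  | d'.+1 => fun W s =>
      if s is j :: s' then
        let x := rsubmx (row j W) in
        let Q := block_mx 1%:M 0 0 (H (rcons h j) d' x) in
        normF x ^+ 2 / d'.+1%:R *
        arp_prob_from H (rcons h j)
          (castmx (erefl n, esym (addSnnS k d')) (W *m Q)) s'
      else 0
  end.

Definition arp_prob (R : rcfType) (n r : nat) (H : reflector_rule R n)
    (V : 'M[R]_(n, r)) (J : r.-tuple 'I_n) : R :=
  arp_prob_from H [::] (k := 0) (d := r) V J.

(* The joint law of the output (I, J) of ARPcross: [Q J] is the orthonormal
   basis computed after J was drawn, and I is drawn by ARP applied to [Q J],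
   conditionally on J. *)
Definition arpcross_prob (R : rcfType) (m n r : nat)
    (HJ : reflector_rule R n) (HI : r.-tuple 'I_n -> reflector_rule R m)
    (V : 'M[R]_(n, r)) (Q : r.-tuple 'I_n -> 'M[R]_(m, r))
    (I : r.-tuple 'I_m) (J : r.-tuple 'I_n) : R :=
  arp_prob HJ V J * arp_prob (HI J) (Q J) I.

Definition arpcross_expectation (R : rcfType) (m n r : nat)
    (HJ : reflector_rule R n) (HI : r.-tuple 'I_n -> reflector_rule R m)
    (V : 'M[R]_(n, r)) (Q : r.-tuple 'I_n -> 'M[R]_(m, r))
    (X : r.-tuple 'I_m -> r.-tuple 'I_n -> R) : R :=
  \sum_(J : r.-tuple 'I_n) \sum_(I : r.-tuple 'I_m)
    arpcross_prob HJ HI V Q I J * X I J.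

Definition arpcross_Pr (R : rcfType) (m n r : nat)
    (HJ : reflector_rule R n) (HI : r.-tuple 'I_n -> reflector_rule R m)
    (V : 'M[R]_(n, r)) (Q : r.-tuple 'I_n -> 'M[R]_(m, r))
    (E : r.-tuple 'I_m -> r.-tuple 'I_n -> bool) : R :=
  \sum_(J : r.-tuple 'I_n) \sum_(I : r.-tuple 'I_m | E I J)
    arpcross_prob HJ HI V Q I J.

Section Submatrices.
Variables (R : rcfType) (m n r : nat) (A : 'M[R]_(m, n)).
Variables (I : r.-tuple 'I_m) (J : r.-tuple 'I_n).

Definition cols_of : 'M[R]_(m, r) := colsub (tnth J) A.
Definition rows_of : 'M[R]_(r, n) := rowsub (tnth I) A.
Definition sub_of : 'M[R]_r := mxsub (tnth I) (tnth J) A.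

Definition cross_approx : 'M[R]_(m, n) := cols_of *m invmx sub_of *m rows_of.

End Submatrices.

(* Main.v *)
(** For V with orthonormal columns and E := B - B V V^T, the interpolation error
    B - B(:,J) V(J,:)^{-T} V^T has squared norm |E|^2 + |X_J|^2, where
    X_J = E(:,J) V(J,:)^{-T}.  That the mean of |X_J|^2 is <= r |E|^2 goes by induction on
    the remaining number d of ARP steps: if F is orthogonal to the d trailing
    columns, a step completes a unit column w, adds the column y = F(:,j) / w_j
    to X and replaces F by F - y w^T, of squared norm |F|^2 + |y|^2.  Since j has
    probability w_j^2 / d, averaging gives
    |F|^2/d + (d-1) (|F|^2 + |F|^2/d) = d |F|^2.
    This yields the factor r + 1 for A and V, and, applied to A^T and Q_J, again
    the factor r + 1 for A(:,J) A(I,J)^{-1} A(I,:) = Q_J Q_J(I,:)^{-1} A(I,:)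
    relative to |A - Q_J Q_J^T A|^2, which is at most the squared error of any
    approximation whose columns lie in the span of A(:,J). *)
Require Import Defs.
From mathcomp Require Import all_boot all_order all_algebra.
From mathcomp Require Import ring.

Set Implicit Arguments.
Unset Strict Implicit.
Unset Printing Implicit Defensive.

Import Order.TTheory GRing.Theory Num.Theory.
Local Open Scope ring_scope.

(** * Summation over tuples, one entry at a time *)

Lemma sum_tupleS (R : nmodType) (T : finType) (d : nat) (f : d.+1.-tuple T -> R) :
  \sum_(s : d.+1.-tuple T) f s = \sum_j \sum_(s : d.-tuple T) f [tuple of j :: s].
Proof.
rewrite pair_bigA (reindex (fun p : T * d.-tuple T => [tuple of p.1 :: p.2])) //.
exists (fun s => (thead s, [tuple of behead s])) => [[j s] _ | s _] /=.
  by congr pair; apply: val_inj.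
by rewrite -tuple_eta.
Qed.

Lemma sum_tuple0 (R : nmodType) (T : finType) (f : 0.-tuple T -> R) :
  \sum_(s : 0.-tuple T) f s = f [tuple].
Proof.
by rewrite (big_pred1 [tuple]) // => s; symmetry; apply/eqP; exact: tuple0.
Qed.

(** * Squared Frobenius norms and orthonormal columns *)

Section FrobeniusOrthonormal.
Variable R : rcfType.

Lemma sqr_normF (m n : nat) (A : 'M[R]_(m, n)) :
  normF A ^+ 2 = \sum_i \sum_j A i j ^+ 2.
Proof.
by rewrite sqr_sqrtr // sumr_ge0 // => i _; rewrite sumr_ge0 // => j _; rewrite sqr_ge0.
Qed.

Lemma sqr_normF_tr (m n : nat) (A : 'M[R]_(m, n)) : normF A ^+ 2 = \tr (A *m A^T).
Proof.
rewrite sqr_normF; apply: eq_bigr => i _; rewrite mxE.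
by apply: eq_bigr => j _; rewrite mxE expr2.
Qed.

Lemma sqr_normF_trmx (m n : nat) (A : 'M[R]_(m, n)) : normF A^T ^+ 2 = normF A ^+ 2.
Proof. by rewrite !sqr_normF_tr trmxK mxtrace_mulC. Qed.

Lemma sqr_normF_sum_row (m n : nat) (A : 'M[R]_(m, n)) :
  normF A ^+ 2 = \sum_i normF (row i A) ^+ 2.
Proof.
rewrite sqr_normF; apply: eq_bigr => i _; rewrite sqr_normF big_ord1.
by apply: eq_bigr => j _; rewrite mxE.
Qed.

Lemma sqr_normF_sum_col (m n : nat) (A : 'M[R]_(m, n)) :
  normF A ^+ 2 = \sum_j normF (col j A) ^+ 2.
Proof.
rewrite -sqr_normF_trmx sqr_normF_sum_row; apply: eq_bigr => j _.
by rewrite -tr_col sqr_normF_trmx.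
Qed.

Lemma sqr_normF_row_mx (m n p : nat) (A : 'M[R]_(m, n)) (B : 'M[R]_(m, p)) :
  normF (row_mx A B) ^+ 2 = normF A ^+ 2 + normF B ^+ 2.
Proof. by rewrite !sqr_normF_tr tr_row_mx mul_row_col mxtraceD. Qed.

Lemma sqr_normF_orthogonal (m n : nat) (A : 'M[R]_(m, n)) (G : 'M[R]_n) :
  G *m G^T = 1%:M -> normF (A *m G) ^+ 2 = normF A ^+ 2.
Proof.
by move=> GG; rewrite !sqr_normF_tr trmx_mul mulmxA -(mulmxA A) GG mulmx1.
Qed.

Lemma sqr_normF_orthonormal (n r : nat) (V : 'M[R]_(n, r)) :
  orthonormal_cols V -> normF V ^+ 2 = r%:R.
Proof. by move=> VV; rewrite sqr_normF_tr mxtrace_mulC VV mxtrace1. Qed.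

Lemma sqr_normFZ (m n : nat) (a : R) (A : 'M[R]_(m, n)) :
  normF (a *: A) ^+ 2 = a ^+ 2 * normF A ^+ 2.
Proof.
by rewrite !sqr_normF_tr linearZ /= -scalemxAl -scalemxAr scalerA mxtraceZ expr2.
Qed.

(** The cross terms contain the factor [E *m V] or its transpose, and [V^T *m V = 1] turns the norm
    of [K *m V^T] into that of [K]. *)
Lemma pythagoras_orthonormal (p n r : nat) (E : 'M[R]_(p, n)) (V : 'M[R]_(n, r))
    (K : 'M[R]_(p, r)) :
  orthonormal_cols V -> E *m V = 0 ->
  normF (E - K *m V^T) ^+ 2 = normF E ^+ 2 + normF K ^+ 2.
Proof.
move=> VV EV; rewrite !sqr_normF_tr linearB /= trmx_mul trmxK.
rewrite mulmxBl !mulmxBr -!mulmxA (mulmxA V^T V) VV mul1mx (mulmxA E) EV mul0mx subr0.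
by rewrite -{1}[V^T *m E^T]trmxK trmx_mul !trmxK EV trmx0 mulmx0 sub0r opprK mxtraceD.
Qed.

Lemma orthonormal_row_mx (n a b : nat) (A : 'M[R]_(n, a)) (B : 'M[R]_(n, b)) :
  orthonormal_cols (row_mx A B) ->
  [/\ orthonormal_cols A, A^T *m B = 0 & orthonormal_cols B].
Proof.
rewrite /orthonormal_cols tr_row_mx mul_col_row scalar_mx_block.
by case/eq_block_mx.
Qed.

Lemma orthonormal_mulmx (n a b : nat) (A : 'M[R]_(n, a)) (G : 'M[R]_(a, b)) :
  orthonormal_cols A -> orthonormal_cols G -> orthonormal_cols (A *m G).
Proof.
by move=> AA GG; rewrite /orthonormal_cols trmx_mul mulmxA -(mulmxA G^T) AA mulmx1.
Qed.

End FrobeniusOrthonormal.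

(** * Interpolation on selected columns under one reflection *)

Lemma row_rsubmx (T : Type) (m n1 n2 : nat) (A : 'M[T]_(m, n1 + n2)) (i : 'I_m) :
  row i (rsubmx A) = rsubmx (row i A).
Proof. by apply/matrixP=> i' j; rewrite !mxE. Qed.

Lemma eq_colsub_cons (T : Type) (n p d : nat) (A B : 'M[T]_(p, n)) j (s : d.-tuple 'I_n) :
  colsub (tnth [tuple of j :: s]) A = colsub (tnth [tuple of j :: s]) B ->
  col j A = col j B /\ colsub (tnth s) A = colsub (tnth s) B.
Proof.
move=> /matrixP AB; split; apply/matrixP => i l; rewrite !mxE.
  by have := AB i ord0; rewrite !mxE tnth0.
by have := AB i (lift ord0 l); rewrite !mxE tnthS.
Qed.

(* If X interpolates F on the columns j :: s, then after the reflection G the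
   first column y of X is fixed by column j alone, and the other columns
   interpolate the deflated matrix [F - y *m w^T] on s. *)
Lemma interpolation_step (R : comNzRingType) (n p d : nat) (F : 'M[R]_(p, n)) (X : 'M[R]_(p, 1 + d))
    (U : 'M[R]_(n, 1 + d)) (G : 'M[R]_(1 + d)) (w : 'cV[R]_n) (U' : 'M[R]_(n, d))
    j (s : d.-tuple 'I_n) :
  G *m G^T = 1%:M -> U *m G = row_mx w U' -> row j U' = 0 ->
  colsub (tnth [tuple of j :: s]) (X *m U^T) = colsub (tnth [tuple of j :: s]) F ->
  let y := lsubmx (X *m G) in
  w j 0 *: y = col j F /\
  colsub (tnth s) (rsubmx (X *m G) *m U'^T) = colsub (tnth s) (F - y *m w^T).
Proof.
move=> GG UG U'j /eq_colsub_cons[Fj Fs] y.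
(* Since [G] is orthogonal, [X *m U^T] is the product of [X *m G] and the transpose of [U *m G],
   which is split after the first column. *)
have XU : X *m U^T = y *m w^T + rsubmx (X *m G) *m U'^T.
  rewrite -mul_row_col -tr_row_mx -UG hsubmxK trmx_mul mulmxA -(mulmxA X).
  by rewrite GG mulmx1.
split.
  rewrite -Fj XU linearD /= !colE -!mulmxA -!colE -!tr_row U'j trmx0 mulmx0 addr0.
  by apply/matrixP => a b; rewrite !ord1 !mxE big_ord1 !mxE mulrC.
by rewrite [RHS]linearB /= -Fs XU linearD /= addrC addKr.
Qed.

(** * One step of ARP, and induction over the remaining steps *)

Section ArpStep.
Variable R : rcfType.

(** With [P = u *m u^T] symmetric and idempotent, the square of [1 - 2 P] is [1 - 4 P + 4 P = 1]. *)
Lemma householder_for_orthogonal (d : nat) (x : 'rV[R]_d.+1) (H : 'M[R]_d.+1) :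
  householder_for x H -> H *m H^T = 1%:M.
Proof.
case=> [[->|[u nu ->]] _]; first by rewrite trmx1 mul1mx.
have uu : u^T *m u = 1%:M.
  apply/matrixP=> i j; rewrite !ord1 [LHS](_ : _ = \tr (u^T *m u)).
    by rewrite mxtrace_mulC -sqr_normF_tr nu expr1n mxE eqxx.
  by rewrite /mxtrace big_ord1.
have PP : (u *m u^T) *m (u *m u^T) = u *m u^T.
  by rewrite mulmxA -(mulmxA u) uu mulmx1.
have PT : (u *m u^T)^T = u *m u^T by rewrite trmx_mul trmxK.
move: (u *m u^T) PP PT => P PP PT.
rewrite [_^T]raddfB /= trmx1 [(_ *: _)^T]linearZ /= PT.
rewrite mulmxBl !mulmxBr mul1mx mulmx1 -!scalemxAl -!scalemxAr. rewrite mul1mx PP.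
by apply/matrixP=> i j; rewrite !mxE; ring.
Qed.


Variables (n : nat) (H : reflector_rule R n).

(** The matrix passed to the recursive call of [arp_prob_from]; the cast moves the completed column
    from the trailing block to the leading one. *)
Definition arp_step (h : seq 'I_n) (k d : nat) (W : 'M[R]_(n, k + d.+1)) (j : 'I_n) :
    'M[R]_(n, k.+1 + d) :=
  castmx (erefl n, esym (addSnnS k d))
    (W *m block_mx 1%:M 0 0 (H (rcons h j) (rsubmx (row j W)))).

Lemma arp_prob_from_cons h k d (W : 'M[R]_(n, k + d.+1)) j s :
  arp_prob_from H h W (j :: s) =
  normF (row j (rsubmx W)) ^+ 2 / d.+1%:R *
    arp_prob_from H (rcons h j) (arp_step h W j) s.
Proof. by rewrite /= row_rsubmx. Qed.

Hypothesis H_valid : valid_rule H.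

(* [w] is the column completed by the step; its entry in row [j] carries the
   whole norm of the trailing part of row [j]. *)
Lemma arp_stepP h k d (W : 'M[R]_(n, k + d.+1)) j :
  exists2 w : 'cV[R]_n,
    exists2 G : 'M[R]_(1 + d), G *m G^T = 1%:M &
      (rsubmx W : 'M_(n, 1 + d)) *m G = row_mx w (rsubmx (arp_step h W j)) &
    row j (rsubmx (arp_step h W j)) = 0 /\
    normF (row j (rsubmx W)) ^+ 2 = w j 0 ^+ 2.
Proof.
set U : 'M[R]_(n, 1 + d) := rsubmx W.
set G : 'M[R]_(1 + d) := H (rcons h j) (rsubmx (row j W)).
have HG := H_valid (rcons h j) (rsubmx (row j W)).
have GG : G *m G^T = 1%:M := householder_for_orthogonal HG.
have [_ [c Gc]] := HG.
have rowG : row j U *m G = row_mx c%:M 0.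
  rewrite row_rsubmx Gc; apply/matrixP => i l; rewrite !mxE ord1 /=.
  rewrite -val_eqE /=.
  by case: splitP => l' ->; rewrite mxE ?ord1 ?eqxx /= ?mulr1 ?mulr0.
(* The cast only renumbers columns: trailing column [l] of the new matrix is column [1 + l] of the
   reflected old trailing block. *)
have stepE : rsubmx (arp_step h W j) = rsubmx (U *m G).
  apply/matrixP => i l; rewrite [LHS]mxE [RHS]mxE castmxE /=.
  have -> : cast_ord (esym (esym (addSnnS k d))) (rshift k.+1 l) = rshift k (rshift 1 l).
    by apply: val_inj; rewrite /= addnA addn1.
  by rewrite cast_ord_id -{1}[W]hsubmxK mul_row_block !mulmx0 add0r row_mxEr.
have UG : U *m G = row_mx (lsubmx (U *m G)) (rsubmx (arp_step h W j)).
  by rewrite stepE hsubmxK.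
exists (lsubmx (U *m G)); first by exists G.
move: rowG; rewrite -row_mul {1}UG row_row_mx => /eq_row_mx[rowl rowr].
split=> //.
rewrite -(sqr_normF_orthogonal (row j U) GG) -row_mul UG row_row_mx rowr.
rewrite sqr_normF_row_mx [normF 0 ^+ 2]sqr_normF_tr mul0mx mxtrace0 addr0.
by rewrite -UG sqr_normF !big_ord1 [row _ _ _ _]mxE.
Qed.


Lemma arp_step_orthonormal h k d (W : 'M[R]_(n, k + d.+1)) j :
  orthonormal_cols (rsubmx W) -> orthonormal_cols (rsubmx (arp_step h W j)).
Proof.
move=> UU; have [w [G GG UG] _] := arp_stepP h W j.
have := orthonormal_mulmx UU (mulmx1C GG).
by rewrite -[rsubmx W *m G]/((rsubmx W : 'M_(n, 1 + d)) *m G) UG => /orthonormal_row_mx[].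
Qed.

Lemma arp_prob_from_ge0 h k d (W : 'M[R]_(n, k + d)) s : 0 <= arp_prob_from H h W s.
Proof.
elim: d => [|d IHd] in h k W s *; first by rewrite /= ler0n.
case: s => [|j s] //; rewrite arp_prob_from_cons.
by rewrite mulr_ge0 ?IHd // divr_ge0 ?sqr_ge0.
Qed.

(** In each step the squared row norms of the trailing block sum to its number of orthonormal
    columns, which is the normalizing denominator. *)
Lemma sum_arp_prob_from h k d (W : 'M[R]_(n, k + d)) :
  orthonormal_cols (rsubmx W) ->
  \sum_(s : d.-tuple 'I_n) arp_prob_from H h W s = 1.
Proof.
elim: d => [|d IHd] in h k W *; first by rewrite sum_tuple0.
move=> UU; rewrite sum_tupleS.
under eq_bigr => j _.
  under eq_bigr => s _ do rewrite arp_prob_from_cons.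
  rewrite -mulr_sumr IHd ?mulr1; last exact: arp_step_orthonormal.
  over.
by rewrite -mulr_suml -sqr_normF_sum_row sqr_normF_orthonormal // divff ?pnatr_eq0.
Qed.

(** Uniqueness of interpolation: positive probability forces [w j 0 != 0], so column [j] kills the
    first column of [X *m G], and induction kills the others. *)
Lemma arp_prob_from_interpolation_eq0 h k d (W : 'M[R]_(n, k + d)) (s : d.-tuple 'I_n)
    p (X : 'M[R]_(p, d)) :
  0 < arp_prob_from H h W s -> colsub (tnth s) (X *m (rsubmx W)^T) = 0 -> X = 0.
Proof.
elim: d => [|d IHd] in h k W s X *.
  by move=> _ _; apply/matrixP => i [].
case/tupleP: s => j s; rewrite arp_prob_from_cons.
have [w [G GG UG] [U'j wj]] := arp_stepP h W j; rewrite wj.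
move=> P_gt0 X0.
have w_neq0 : w j 0 != 0.
  by apply: contraTneq P_gt0 => ->; rewrite expr0n !mul0r ltxx.
have P'_gt0 : 0 < arp_prob_from H (rcons h j) (arp_step h W j) s.
  rewrite lt0r arp_prob_from_ge0 andbT.
  by apply: contraTneq P_gt0 => ->; rewrite mulr0 ltxx.
have /(interpolation_step GG UG U'j)[] :
    colsub (tnth [tuple of j :: s]) (X *m (rsubmx W)^T) =
    colsub (tnth [tuple of j :: s]) (0 : 'M_(p, n)).
  by rewrite X0; apply/matrixP=> a b; rewrite !mxE.
have -> : col j (0 : 'M[R]_(p, n)) = 0 by apply/matrixP=> a b; rewrite !mxE.
move/eqP; rewrite scaler_eq0 (negbTE w_neq0) /= => /eqP y0.
rewrite y0 mul0mx subr0 => Y0.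
suff XG0 : (X : 'M_(p, 1 + d)) *m G = 0 by rewrite -[X]mulmx1 -GG mulmxA XG0 mul0mx.
have R0 : rsubmx ((X : 'M_(p, 1 + d)) *m G) = 0.
  by apply: (IHd _ _ _ _ _ P'_gt0); rewrite Y0; apply/matrixP=> a b; rewrite !mxE.
by rewrite -[LHS]hsubmxK y0 R0 row_mx0.
Qed.

Lemma arp_interpolation_bound h k d (W : 'M[R]_(n, k + d)) p (F : 'M[R]_(p, n))
    (X : d.-tuple 'I_n -> 'M[R]_(p, d)) :
  orthonormal_cols (rsubmx W) -> F *m rsubmx W = 0 ->
  (forall s : d.-tuple 'I_n, 0 < arp_prob_from H h W s ->
     colsub (tnth s) (X s *m (rsubmx W)^T) = colsub (tnth s) F) ->
  \sum_(s : d.-tuple 'I_n) arp_prob_from H h W s * normF (X s) ^+ 2 <=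
  d%:R * normF F ^+ 2.
Proof.
elim: d => [|d IHd] in h k W F X *.
  move=> _ _ _; rewrite sum_tuple0 sqr_normF mul0r.
  by rewrite big1 ?mulr0 // => i _; rewrite big_ord0.
move=> UU FU XF.
(* The contribution of a fixed first index, with [w_j^2 |y|^2] written as the squared norm of column
   [j] of [F], so that the bound makes sense for [w_j = 0] too. Summed over [j], it gives
   [d |F|^2 + |F|^2]. *)
have bound_j j : \sum_(s : d.-tuple 'I_n) arp_prob_from H h W (j :: s) *
      normF (X [tuple of j :: s]) ^+ 2 <=
    normF (row j (rsubmx W)) ^+ 2 * (d%:R / d.+1%:R * normF F ^+ 2) + normF (col j F) ^+ 2.
  have [w [G GG UG] [U'j wj]] := arp_stepP h W j.
  under eq_bigr => s _ do rewrite arp_prob_from_cons.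
  set W' := arp_step h W j in UG U'j *; rewrite wj.
  (* If [w_j = 0], then [j] is drawn with probability zero and the left side vanishes. *)
  have [w0|w_neq0] := eqVneq (w j 0) 0.
    rewrite w0 expr0n !mul0r add0r big1 ?sqr_ge0 // => s _.
    by rewrite !mul0r.
  have W'U := arp_step_orthonormal h j UU; rewrite -/W' in W'U.
  have := orthonormal_mulmx UU (mulmx1C GG).
  rewrite -[rsubmx W *m G]/((rsubmx W : 'M_(n, 1 + d)) *m G) UG.
  case/orthonormal_row_mx => ww wU' _.
  have /eq_row_mx[Fw FU'] : row_mx (F *m w) (F *m rsubmx W') = row_mx 0 0.
    by rewrite -mul_mx_row -UG mulmxA FU mul0mx row_mx0.
  pose y := (w j 0)^-1 *: col j F.
  pose F' := F - y *m w^T.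
  (* [w] is a unit column, and [F *m w = 0] because [w] lies in the span of the trailing block. *)
  have nF' : normF F' ^+ 2 = normF F ^+ 2 + normF y ^+ 2.
    exact: pythagoras_orthonormal.
  have F'U' : F' *m rsubmx W' = 0.
    by rewrite mulmxBl FU' -mulmxA wU' mulmx0 subr0.
  pose Y (s : d.-tuple 'I_n) : 'M[R]_(p, d) := rsubmx ((X [tuple of j :: s] : 'M_(p, 1 + d)) *m G).
  have stepX (s : d.-tuple 'I_n) : 0 < arp_prob_from H (rcons h j) W' s ->
      lsubmx ((X [tuple of j :: s] : 'M_(p, 1 + d)) *m G) = y /\
      colsub (tnth s) (Y s *m (rsubmx W')^T) = colsub (tnth s) F'.
    move=> P'_gt0.
    have /(interpolation_step GG UG U'j)[] :
        colsub (tnth [tuple of j :: s]) (X [tuple of j :: s] *m (rsubmx W)^T) =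
        colsub (tnth [tuple of j :: s]) F.
      apply: XF; rewrite arp_prob_from_cons wj mulr_gt0 // divr_gt0 //.
      by rewrite exprn_even_gt0.
    move=> yE YE.
    have y_eq : lsubmx ((X [tuple of j :: s] : 'M_(p, 1 + d)) *m G) = y.
      by rewrite /y -yE scalerA mulVf // scale1r.
    by split=> //; rewrite YE y_eq.
  have IH := IHd (rcons h j) _ W' F' Y W'U F'U' (fun s P => (stepX s P).2).
  (* Either both sides have weight zero, or the orthogonal [G] preserves the norm and [X *m G]
     splits into [y] and [Y s]. *)
  have term (s : d.-tuple 'I_n) : arp_prob_from H (rcons h j) W' s * normF (X [tuple of j :: s]) ^+ 2 =
      arp_prob_from H (rcons h j) W' s * normF y ^+ 2 +
      arp_prob_from H (rcons h j) W' s * normF (Y s) ^+ 2.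
    have := arp_prob_from_ge0 (rcons h j) W' s.
    rewrite le_eqVlt => /predU1P[<-|P'_gt0]; first by rewrite !mul0r addr0.
    rewrite -mulrDr -(sqr_normF_orthogonal _ GG).
    rewrite -[_ *m _]/((X [tuple of j :: s] : 'M_(p, 1 + d)) *m G).
    by rewrite -[X in normF X]hsubmxK sqr_normF_row_mx (stepX s P'_gt0).1.
  under eq_bigr => s _ do rewrite -mulrA term.
  rewrite -mulr_sumr big_split /= -mulr_suml sum_arp_prob_from // mul1r.
  have ny : normF (col j F) ^+ 2 = w j 0 ^+ 2 * normF y ^+ 2.
    by rewrite sqr_normFZ mulrA -exprMn divff // expr1n mul1r.
  have -> : w j 0 ^+ 2 * (d%:R / d.+1%:R * normF F ^+ 2) + normF (col j F) ^+ 2 =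
      w j 0 ^+ 2 / d.+1%:R * (normF y ^+ 2 + d%:R * normF F' ^+ 2).
    by rewrite ny nF' -(natr1 d); field; rewrite natr1 pnatr_eq0.
  rewrite ler_wpM2l ?lerD2l //.
  by rewrite divr_ge0 ?sqr_ge0.
rewrite sum_tupleS (le_trans (ler_sum _ (fun j _ => bound_j j))) //.
rewrite big_split /= -mulr_suml -sqr_normF_sum_row -sqr_normF_sum_col.
rewrite sqr_normF_orthonormal // mulrA [_ * (_ / _)]mulrC divfK ?pnatr_eq0 //.
by rewrite -(natr1 d) mulrDl mul1r.
Qed.

End ArpStep.

(** * Expected interpolation error of ARP *)

Section ArpError.
Variables (R : rcfType) (n r : nat) (H : reflector_rule R n) (V : 'M[R]_(n, r)).
Hypothesis H_valid : valid_rule H.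

Lemma rsubmx_full : rsubmx (V : 'M_(n, 0 + r)) = V.
Proof. by apply/matrixP=> i j; rewrite !mxE; congr (V i _); apply: val_inj. Qed.

Lemma arp_prob_ge0 (J : r.-tuple 'I_n) : 0 <= arp_prob H V J.
Proof. exact: arp_prob_from_ge0. Qed.

(** A row vector [z] killed by the transpose of V(J,:) makes [z *m V^T] vanish on the columns [J],
    hence is zero by uniqueness of interpolation. *)
Lemma arp_prob_gt0_unitmx (J : r.-tuple 'I_n) :
  0 < arp_prob H V J -> rowsub (tnth J) V \in unitmx.
Proof.
move=> J_gt0; rewrite -unitmx_tr -row_free_unit; apply: inj_row_free => z zV.
apply: (arp_prob_from_interpolation_eq0 H_valid J_gt0).
by rewrite rsubmx_full -mulmx_colsub -trmx_mxsub.
Qed.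

Hypothesis V_orth : orthonormal_cols V.

Lemma sum_arp_prob : \sum_(J : r.-tuple 'I_n) arp_prob H V J = 1.
Proof. by apply: sum_arp_prob_from; rewrite ?rsubmx_full. Qed.

Lemma arp_error_bound p (B : 'M[R]_(p, n)) :
  \sum_(J : r.-tuple 'I_n) arp_prob H V J *
    normF (B - colsub (tnth J) B *m (invmx (rowsub (tnth J) V))^T *m V^T) ^+ 2 <=
  r.+1%:R * normF (B - B *m V *m V^T) ^+ 2.
Proof.
set E := B - B *m V *m V^T.
have EV : E *m V = 0 by rewrite mulmxBl -(mulmxA (B *m V)) V_orth mulmx1 subrr.
pose X (J : r.-tuple 'I_n) := colsub (tnth J) E *m (invmx (rowsub (tnth J) V))^T.
have term (J : r.-tuple 'I_n) : arp_prob H V J *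
      normF (B - colsub (tnth J) B *m (invmx (rowsub (tnth J) V))^T *m V^T) ^+ 2 =
    arp_prob H V J * normF E ^+ 2 + arp_prob H V J * normF (X J) ^+ 2.
  (* For [J] of probability zero, V(J,:) may be singular and [invmx] a mere default value, but the
     weight vanishes. *)
  have := arp_prob_ge0 J; rewrite le_eqVlt => /predU1P[<-|J_gt0].
    by rewrite !mul0r addr0.
  have VJ := arp_prob_gt0_unitmx J_gt0.
  rewrite -mulrDr -(pythagoras_orthonormal (X J) V_orth EV); congr (_ * normF _ ^+ 2).
  (* As V(J,:) is invertible, the part [B *m V *m V^T] of [B] is reproduced exactly; hence the error
     is [E - X J *m V^T]. *)
  have -> : X J = colsub (tnth J) B *m (invmx (rowsub (tnth J) V))^T - B *m V.
    rewrite /X /E linearB /= mulmxBl -mulmx_colsub -trmx_mxsub -(mulmxA (B *m V)).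
    by rewrite -trmx_mul mulVmx // trmx1 mulmx1.
  by rewrite mulmxBl opprB addrA subrK.
under eq_bigr => J _ do rewrite term.
rewrite big_split /= -mulr_suml sum_arp_prob mul1r -natr1 addrC mulrDl mul1r lerD2r.
apply: (@arp_interpolation_bound R n H H_valid [::] 0 r V p E X).
- by rewrite rsubmx_full.
- by rewrite rsubmx_full.
move=> J J_gt0; rewrite rsubmx_full -mulmx_colsub /X -trmx_mxsub -mulmxA -trmx_mul.
by rewrite mulmxV ?trmx1 ?mulmx1 // arp_prob_gt0_unitmx.
Qed.

End ArpError.

(** * Best approximation in a column span, and the cross approximation *)

Lemma normF_proj_le (R : rcfType) (m n r : nat) (A : 'M[R]_(m, n)) (Q : 'M[R]_(m, r))
    (Z : 'M[R]_(r, n)) :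
  orthonormal_cols Q -> normF (A^T - A^T *m Q *m Q^T) ^+ 2 <= normF (A - Q *m Z) ^+ 2.
Proof.
move=> QQ; set E := A^T - _.
have EQ : E *m Q = 0 by rewrite mulmxBl -(mulmxA (A^T *m Q)) QQ mulmx1 subrr.
rewrite -[normF (A - _) ^+ 2]sqr_normF_trmx.
(* The error of any competitor is the projection error [E] plus a term orthogonal to it, so
   Pythagoras applies. *)
have -> : (A - Q *m Z)^T = E - (Z^T - A^T *m Q) *m Q^T.
  by rewrite [LHS]raddfB /= trmx_mul mulmxBl opprB addrA subrK.
by rewrite pythagoras_orthonormal // lerDl sqr_ge0.
Qed.

(** A(I,J) factors as Q(I,:) [N]; its invertibility makes both square factors invertible, and [N]
    cancels. *)
Lemma cross_approx_colbasis (R : rcfType) (m n r : nat) (A : 'M[R]_(m, n))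
    (I : r.-tuple 'I_m) (J : r.-tuple 'I_n) (Q : 'M[R]_(m, r)) (N : 'M[R]_r) :
  cols_of A J = Q *m N -> sub_of A I J \in unitmx ->
  cross_approx A I J = Q *m invmx (rowsub (tnth I) Q) *m rows_of A I.
Proof.
move=> QN; have subE : sub_of A I J = rowsub (tnth I) Q *m N.
  by rewrite mul_rowsub_mx -QN; apply/matrixP=> i j; rewrite !mxE.
rewrite subE unitmx_mul => /andP[QI N_unit].
rewrite /cross_approx QN subE; congr (_ *m _).
rewrite -mulmxA; congr (_ *m _).
apply: (can_inj (mulmxK QI)); rewrite mulVmx //.
rewrite -mulmxA; apply: (can_inj (mulmxK N_unit)).
by rewrite mul1mx -!mulmxA mulVmx ?mulmx1 // unitmx_mul QI.
Qed.

Theorem theorem4p1 (R : rcfType) (m n r : nat)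
    (A : 'M[R]_(m, n)) (V : 'M[R]_(n, r)) (HV : orthonormal_cols V)
    (HJ : reflector_rule R n) (HI : r.-tuple 'I_n -> reflector_rule R m)
    (HJ_valid : valid_rule HJ)
    (HI_valid : forall J : r.-tuple 'I_n, valid_rule (HI J))
    (Q : r.-tuple 'I_n -> 'M[R]_(m, r))
    (HQ : forall J : r.-tuple 'I_n, 0 < arp_prob HJ V J ->
       orthonormal_colbasis (Q J) (cols_of A J))
    (Hinv : arpcross_Pr HJ HI V Q (fun I J => sub_of A I J \in unitmx) = 1) :
  arpcross_expectation HJ HI V Q
    (fun I J => normF (A - cross_approx A I J) ^+ 2) <=
  (r.+1%:R) ^+ 2 * normF (A - A *m V *m V^T) ^+ 2.
Proof.
have pJ_ge0 := arp_prob_ge0 HJ V.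
have pI_ge0 J := arp_prob_ge0 (HI J) (Q J).
have law_ge0 I J : 0 <= arpcross_prob HJ HI V Q I J by rewrite mulr_ge0.
have total : \sum_J \sum_I arpcross_prob HJ HI V Q I J = 1.
  rewrite -(sum_arp_prob HJ_valid HV); apply: eq_bigr => J _.
  rewrite -mulr_sumr; have := pJ_ge0 J; rewrite le_eqVlt => /predU1P[<-|J_gt0].
    by rewrite mul0r.
  by rewrite sum_arp_prob ?mulr1 //; case: (HQ J J_gt0).
(* The total mass and the mass of the invertible pairs are both 1, so the nonnegative masses of the
   singular pairs sum to zero and vanish one by one. *)
have sing0 I J : sub_of A I J \notin unitmx -> arpcross_prob HJ HI V Q I J = 0.
  have : \sum_J \sum_(I | sub_of A I J \notin unitmx) arpcross_prob HJ HI V Q I J = 0.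
    apply: (addrI 1); rewrite -{1}Hinv addr0 -big_split -[RHS]total /=.
    by apply: eq_bigr => J' _; rewrite [RHS](bigID (fun I => sub_of A I J' \in unitmx)).
  move/psumr_eq0P => sumJ0; apply: (psumr_eq0P _ (sumJ0 _ J _)) => // J' _.
  exact: sumr_ge0.
rewrite /arpcross_expectation expr2 -mulrA.
(* The first factor [r + 1] comes from drawing [J]. It remains to bound, for each [J], the
   conditional mean over [I] by [r + 1] times the interpolation error for [J]. *)
apply: le_trans _ (ler_wpM2l (ler0n _ _) (arp_error_bound HJ_valid HV A)).
rewrite mulr_sumr; apply: ler_sum => J _.
have := pJ_ge0 J; rewrite le_eqVlt => /predU1P[J_eq0|J_gt0].
  by rewrite -J_eq0 mul0r mulr0 big1 // => I _; rewrite /arpcross_prob -J_eq0 !mul0r.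
(* Equality of column spaces is used only to write A(:,J) as [Q J] times a coefficient matrix. *)
have [QQ /andP[_ /submxP[N /(canRL trmxK)]]] := HQ J J_gt0.
rewrite trmx_mul trmxK => QN.
rewrite mulrCA; under eq_bigr => I _ do rewrite -mulrA.
rewrite -mulr_sumr ler_wpM2l //.
(* The interpolant for [J] now has the form [Q J *m Z], so its error dominates that of the
   projection onto the span of [Q J]. *)
rewrite -[colsub (tnth J) A]/(cols_of A J) QN -!mulmxA.
apply: le_trans _ (ler_wpM2l (ler0n _ _) (normF_proj_le A _ QQ)).
(* Drawing rows of [A] through [Q J] is drawing columns of [A^T], which gives the second factor
   [r + 1]. *)
apply: le_trans _ (arp_error_bound (HI_valid J) QQ A^T); apply: ler_sum => I _.
have := pI_ge0 J I; rewrite le_eqVlt => /predU1P[<-|I_gt0]; first by rewrite !mul0r.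
have sub_unit : sub_of A I J \in unitmx.
  by apply: contraT => /sing0/eqP; rewrite mulf_eq0 !gt_eqF.
rewrite (cross_approx_colbasis QN sub_unit) -[normF (A - _) ^+ 2]sqr_normF_trmx.
by rewrite [(A - _)^T]raddfB /= !trmx_mul -mulmxA trmx_mxsub.
Qed.
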